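(* For any two $n$-mode raw LOPP-circuits $C_1,C_2$, one has $\mathrm{LOPP}\vdash C_1=C_2$ if and only if $[\![C_1]\!]=[\![C_2]\!]$.
   Context: Raw LOPP-circuits are terms generated from the following generators, with their numbers of modes (inputs = outputs): the phase shifter $\mathrm{ph}(\varphi)$ on $1$ mode for each $\varphi\in\mathbb R$; the beam splitter $\mathrm{bs}(\theta)$ on $2$ modes for each $\theta\in\mathbb R$; the identity wire $\mathrm{id}$ on $1$ mode; the swap $\mathrm{sw}$ on $2$ modes; and the empty circuit $e$ on $0$ modes. They are combined by sequential composition $C_2\circ C_1$, defined when both act on the same number of modes, and by parallel composition $C_1\otimes C_2$, in which the modes of $C_1$ are placed above those of $C_2$. Semantics. To an $n$-mode raw circuit one associates an $n\times n$ matrix $[\![\cdot]\!]$, with $[\![C_2\circ C_1]\!]=[\![C_2]\!][\![C_1]\!]$ and $[\![C_1\otimes C_3]\!]=[\![C_1]\!]\oplus[\![C_3]\!]$ (block-diagonal). On generators: $[\![\mathrm{ph}(\varphi)]\!]=(e^{i\varphi})$, $[\![\mathrm{bs}(\theta)]\!]=\begin{pmatrix}\cos\theta&i\sin\theta\\ i\sin\theta&\cos\theta\end{pmatrix}$, $[\![\mathrm{sw}]\!]=\begin{pmatrix}0&1\\1&0\end{pmatrix}$, $[\![\mathrm{id}]\!]=(1)$, and $[\![e]\!]$ is the map on $\mathbb C^0$. Notation. Set $id_0=e$ and $id_{k+1}=id_k\otimes\mathrm{id}$. Set $\sigma_0=\mathrm{id}$ and $\sigma_{k+1}=(\mathrm{sw}\otimes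 id_k)\circ(\mathrm{id}\otimes\sigma_k)$. Modes are numbered $0,1,2,\dots$ from top to bottom. Definition of $\mathrm{LOPP}\vdash C_1=C_2$. It is the smallest equivalence relation on raw circuits that is a congruence for $\circ$ and $\otimes$ and contains the structural axioms and axioms (A)–(G) below, for all circuits and angles for which both sides are defined. Structural axioms: - $id_k\circ C=C=C\circ id_k$; - $(C_3\circ C_2)\circ C_1=C_3\circ(C_2\circ C_1)$; - $e\otimes C=C=C\otimes e$; - $(C_1\otimes C_2)\otimes C_3=C_1\otimes(C_2\otimes C_3)$; - $(C_2\circ C_1)\otimes(C_4\circ C_3)=(C_2\otimes C_4)\circ(C_1\otimes C_3)$; - $\sigma_k\circ(C\otimes\mathrm{id})=(\mathrm{id}\otimes C)\circ\sigma_k$ for every $k$-mode $C$; - $\mathrm{sw}\circ\mathrm{sw}=\mathrm{id}\otimes\mathrm{id}$. Axioms: - (A) $\mathrm{ph}(0)=\mathrm{ph}(2\pi)=\mathrm{id}$. - (B) $\mathrm{bs}(0)=\mathrm{id}\otimes\mathrm{id}$. - (C) $\mathrm{sw}=(\mathrm{ph}(-\pi/2)\otimes\mathrm{ph}(-\pi/2))\circ\mathrm{bs}(\pi/2)$. - (D) $\mathrm{ph}(\varphi_2)\circ\mathrm{ph}(\varphi_1)=\mathrm{ph}(\varphi_1+\varphi_2)$. - (E) $\mathrm{bs}(\theta)\circ(\mathrm{ph}(\varphi)\otimes\mathrm{ph}(\varphi))=(\mathrm{ph}(\varphi)\otimes\mathrm{ph}(\varphi))\circ\mathrm{bs}(\theta)$.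 - (F) For all $\alpha_1,\alpha_2,\alpha_3\in\mathbb R$: $$\mathrm{bs}(\alpha_3)\circ(\mathrm{ph}(\alpha_2)\otimes\mathrm{id})\circ\mathrm{bs}(\alpha_1)=(\mathrm{ph}(\beta_3)\otimes\mathrm{ph}(\beta_4))\circ\mathrm{bs}(\beta_2)\circ(\mathrm{ph}(\beta_1)\otimes\mathrm{id}),$$ where $\beta_1,\dots,\beta_4\in[0,2\pi)$ are the unique angles making the two sides have the same semantics under the constraints $\beta_1,\beta_2\in[0,\pi)$ and ($\beta_2\in\{0,\pi/2\}\Rightarrow\beta_1=0$). - (G) On $3$ modes, write $B_{01}(\theta)=\mathrm{bs}(\theta)\otimes\mathrm{id}$, $B_{12}(\theta)=\mathrm{id}\otimes\mathrm{bs}(\theta)$, $\Phi_0(\varphi)=\mathrm{ph}(\varphi)\otimes\mathrm{id}\otimes\mathrm{id}$, $\Phi_1(\varphi)=\mathrm{id}\otimes\mathrm{ph}(\varphi)\otimes\mathrm{id}$, and $\Phi_2(\varphi)=\mathrm{id}\otimes\mathrm{id}\otimes\mathrm{ph}(\varphi)$. For all $\gamma_1,\dots,\gamma_4\in\mathbb R$: $$B_{01}(\gamma_4)\circ B_{12}(\gamma_3)\circ\Phi_0(\gamma_2)\circ B_{01}(\gamma_1)=\Phi_2(\delta_9)\circ\Phi_1(\delta_8)\circ\Phi_0(\delta_7)\circ B_{12}(\delta_6)\circ\Phi_1(\delta_5)\circ B_{01}(\delta_4)\circ B_{12}(\delta_3)\circ\Phi_0(\delta_2)\circ\Phi_1(\delta_1),$$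 where $\delta_1,\dots,\delta_9\in[0,2\pi)$ are the unique angles making the two sides have the same semantics under the constraints: - $\delta_1,\dots,\delta_6\in[0,\pi)$; - $\delta_3\in\{0,\pi/2\}\Rightarrow\delta_1=0$; - $\delta_4\in\{0,\pi/2\}\Rightarrow\delta_2=0$; - $\delta_4=0\Rightarrow\delta_3=0$; - $\delta_6\in\{0,\pi/2\}\Rightarrow\delta_5=0$. *)

(* Defs.v *)
From HB Require Import structures.
From mathcomp Require Import all_boot all_order all_algebra.
From mathcomp Require Import reals trigo.
From mathcomp Require Import complex.

Set Implicit Arguments.
Unset Strict Implicit.
Unset Printing Implicit Defensive.

Import Order.TTheory GRing.Theory Num.Theory.
Local Open Scope ring_scope.
Local Open Scope complex_scope.

Section LOPP.
Variable R : realType.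

Inductive circ : Type :=
  | ph  : R -> circ
  | bs  : R -> circ
  | idw : circ
  | sw  : circ
  | emp : circ
  | cseq : circ -> circ -> circ   (* cseq C2 C1 = C2 \circ C1 *)
  | cpar : circ -> circ -> circ.  (* cpar C1 C2 = C1 \otimes C2, C1 above C2 *)

Fixpoint arity (c : circ) : nat :=
  match c with
  | ph _ => 1%N | bs _ => 2%N | idw => 1%N | sw => 2%N | emp => 0%N
  | cseq _ c1 => arity c1
  | cpar c1 c2 => (arity c1 + arity c2)%N
  end.

Fixpoint wf (c : circ) : bool :=
  match c with
  | cseq c2 c1 => [&& wf c2, wf c1 & arity c2 == arity c1]
  | cpar c1 c2 => wf c1 && wf c2
  | _ => true
  end.

Definition nmode (n : nat) (c : circ) : Prop := wf c /\ arity c = n.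

Definition mx2 (a b c d : R[i]) : 'M[R[i]]_2 :=
  \matrix_(i < 2, j < 2)
    if (i == 0 :> nat) then (if (j == 0 :> nat) then a else b)
    else (if (j == 0 :> nat) then c else d).

Definition expi (phi : R) : R[i] := (cos phi) +i* (sin phi).

(** Semantics (for ill-formed sequential compositions the type-mismatched
    factor is replaced by 0 via conform_mx; irrelevant for well-formed circuits). *)
Fixpoint sem (c : circ) : 'M[R[i]]_(arity c) :=
  match c return 'M[R[i]]_(arity c) with
  | ph phi => (expi phi)%:M
  | bs t => mx2 ((cos t)%:C) (0 +i* sin t) (0 +i* sin t) ((cos t)%:C)
  | idw => 1%:M
  | sw => mx2 0 1 1 0
  | emp => 0
  | cseq c2 c1 => conform_mx 0 (sem c2) *m sem c1
  | cpar c1 c2 => block_mx (sem c1) 0 0 (sem c2)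
  end.

(** Semantics as an n x n matrix (equals [sem c] when [arity c = n]). *)
Definition semn (n : nat) (c : circ) : 'M[R[i]]_n := conform_mx 0 (sem c).

Fixpoint idk (k : nat) : circ :=
  match k with O => emp | S k' => cpar (idk k') idw end.

Fixpoint sigma (k : nat) : circ :=
  match k with
  | O => idw
  | S k' => cseq (cpar sw (idk k')) (cpar idw (sigma k'))
  end.

Definition B01 (t : R) := cpar (bs t) idw.
Definition B12 (t : R) := cpar idw (bs t).
Definition Phi0 (p : R) := cpar (cpar (ph p) idw) idw.
Definition Phi1 (p : R) := cpar (cpar idw (ph p)) idw.
Definition Phi2 (p : R) := cpar (cpar idw idw) (ph p).

Definition in02pi (x : R) : Prop := 0 <= x < 2 * pi.
Definition in0pi (x : R) : Prop := 0 <= x < pi.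

Definition F_lhs (a1 a2 a3 : R) : circ :=
  cseq (bs a3) (cseq (cpar (ph a2) idw) (bs a1)).
Definition F_rhs (b1 b2 b3 b4 : R) : circ :=
  cseq (cpar (ph b3) (ph b4)) (cseq (bs b2) (cpar (ph b1) idw)).

Definition G_lhs (g1 g2 g3 g4 : R) : circ :=
  cseq (B01 g4) (cseq (B12 g3) (cseq (Phi0 g2) (B01 g1))).
Definition G_rhs (d1 d2 d3 d4 d5 d6 d7 d8 d9 : R) : circ :=
  cseq (Phi2 d9) (cseq (Phi1 d8) (cseq (Phi0 d7) (cseq (B12 d6)
    (cseq (Phi1 d5) (cseq (B01 d4) (cseq (B12 d3) (cseq (Phi0 d2) (Phi1 d1)))))))).

Definition F_angles (a1 a2 a3 b1 b2 b3 b4 : R) : Prop :=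
  (in02pi b1 /\ in02pi b2 /\ in02pi b3 /\ in02pi b4) /\
  (in0pi b1 /\ in0pi b2) /\
  ((b2 = 0 \/ b2 = pi / 2) -> b1 = 0) /\
  semn 2 (F_lhs a1 a2 a3) = semn 2 (F_rhs b1 b2 b3 b4).

Definition G_angles (g1 g2 g3 g4 d1 d2 d3 d4 d5 d6 d7 d8 d9 : R) : Prop :=
  (forall d, d \in [:: d1; d2; d3; d4; d5; d6; d7; d8; d9] -> in02pi d) /\
  (forall d, d \in [:: d1; d2; d3; d4; d5; d6] -> in0pi d) /\
  ((d3 = 0 \/ d3 = pi / 2) -> d1 = 0) /\
  ((d4 = 0 \/ d4 = pi / 2) -> d2 = 0) /\
  (d4 = 0 -> d3 = 0) /\
  ((d6 = 0 \/ d6 = pi / 2) -> d5 = 0) /\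
  semn 3 (G_lhs g1 g2 g3 g4) = semn 3 (G_rhs d1 d2 d3 d4 d5 d6 d7 d8 d9).

Inductive lopp : circ -> circ -> Prop :=
  | lopp_refl c : lopp c c
  | lopp_sym c1 c2 : lopp c1 c2 -> lopp c2 c1
  | lopp_trans c1 c2 c3 : lopp c1 c2 -> lopp c2 c3 -> lopp c1 c3
  | lopp_cseq c1 c1' c2 c2' :
      lopp c1 c1' -> lopp c2 c2' -> lopp (cseq c2 c1) (cseq c2' c1')
  | lopp_cpar c1 c1' c2 c2' :
      lopp c1 c1' -> lopp c2 c2' -> lopp (cpar c1 c2) (cpar c1' c2')
  | ax_idl k c : nmode k c -> lopp (cseq (idk k) c) c
  | ax_idr k c : nmode k c -> lopp (cseq c (idk k)) c
  | ax_seqA c1 c2 c3 : wf c1 -> wf c2 -> wf c3 ->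
      arity c1 = arity c2 -> arity c2 = arity c3 ->
      lopp (cseq (cseq c3 c2) c1) (cseq c3 (cseq c2 c1))
  | ax_empl c : wf c -> lopp (cpar emp c) c
  | ax_empr c : wf c -> lopp (cpar c emp) c
  | ax_parA c1 c2 c3 : wf c1 -> wf c2 -> wf c3 ->
      lopp (cpar (cpar c1 c2) c3) (cpar c1 (cpar c2 c3))
  | ax_interchange c1 c2 c3 c4 : wf c1 -> wf c2 -> wf c3 -> wf c4 ->
      arity c1 = arity c2 -> arity c3 = arity c4 ->
      lopp (cpar (cseq c2 c1) (cseq c4 c3)) (cseq (cpar c2 c4) (cpar c1 c3))
  | ax_sigma k c : nmode k c ->
      lopp (cseq (sigma k) (cpar c idw)) (cseq (cpar idw c) (sigma k))
  | ax_swsw : lopp (cseq sw sw) (cpar idw idw)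
  | ax_A0 : lopp (ph 0) idw
  | ax_A2pi : lopp (ph (2 * pi)) idw
  | ax_B : lopp (bs 0) (cpar idw idw)
  | ax_C : lopp sw (cseq (cpar (ph (- (pi / 2))) (ph (- (pi / 2)))) (bs (pi / 2)))
  | ax_D p1 p2 : lopp (cseq (ph p2) (ph p1)) (ph (p1 + p2))
  | ax_E t p : lopp (cseq (bs t) (cpar (ph p) (ph p)))
                    (cseq (cpar (ph p) (ph p)) (bs t))
  | ax_F a1 a2 a3 b1 b2 b3 b4 : F_angles a1 a2 a3 b1 b2 b3 b4 ->
      lopp (F_lhs a1 a2 a3) (F_rhs b1 b2 b3 b4)
  | ax_G g1 g2 g3 g4 d1 d2 d3 d4 d5 d6 d7 d8 d9 :
      G_angles g1 g2 g3 g4 d1 d2 d3 d4 d5 d6 d7 d8 d9 ->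
      lopp (G_lhs g1 g2 g3 g4) (G_rhs d1 d2 d3 d4 d5 d6 d7 d8 d9).

End LOPP.

(* Main.v *)
Require Import Defs.
From HB Require Import structures.
From Stdlib Require Import Setoid Morphisms.
From mathcomp Require Import all_boot all_order all_algebra.
From mathcomp Require Import zify ring lra.
From mathcomp Require Import boolp reals trigo.
From mathcomp Require Import complex.

Set Implicit Arguments.
Unset Strict Implicit.
Unset Printing Implicit Defensive.

Import Order.TTheory GRing.Theory Num.Theory.
Local Open Scope ring_scope.
Local Open Scope complex_scope.

(* Soundness is checked on the action on vectors.  For completeness, (C) turns a
   circuit into a word of phase shifters and beam splitters.  Call a staircase
   from mode k a word sending the k-th basis vector to an arbitrary unit vector
   supported on the modes >= k by beam splitters on (k,k+1), (k+1,k+2), ... and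
   phases.  Multiplying a staircase on the left by any gate on the modes >= k
   gives again a staircase, up to gates on the modes > k on its right: the only
   nontrivial case is bs on (k,k+1), which is an instance of (F) or (G) once
   phases have been moved around with (E).  Hence every word is equivalent to
   S_0 S_1 ... S_(n-1) with S_k a staircase from k.  If the word acts as the
   identity, then S_0 fixes the 0-th basis vector, which forces its first beam
   splitter and phase to be trivial, so that the word can be rewritten on the
   modes >= 1, and so on down to the empty word.  Since words are invertible,
   this settles the general case.  The angles required by (F) and (G) exist
   because a unit row of length 2 or 3 can be matched by the parameters, and the
   rest of a unitary matrix is then a smaller unitary block. *)

(** * Action of circuits on vectors and soundness *)

Section Action.
Variable R : realType.
Implicit Types (c : circ R) (v : nat -> R[i]).

(* The action is on infinite families, whose entries beyond the arity are left
   alone, so that no cast between dimensions is ever needed. *)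
Fixpoint act c v : nat -> R[i] :=
  match c with
  | ph p => fun j => if j is 0%N then expi p * v 0%N else v j
  | bs t => fun j => match j with
      | 0%N => (cos t)%:C * v 0%N + (0 +i* sin t) * v 1%N
      | 1%N => (0 +i* sin t) * v 0%N + (cos t)%:C * v 1%N
      | _ => v j end
  | idw | emp => v
  | sw => fun j => match j with 0%N => v 1%N | 1%N => v 0%N | _ => v j end
  | cseq c2 c1 => act c2 (act c1 v)
  | cpar c1 c2 => fun j => if (j < arity c1)%N then act c1 v j
      else act c2 (fun i => v (arity c1 + i)%N) (j - arity c1)%N
  end.

Lemma act_out c v j : wf c -> (arity c <= j)%N -> act c v j = v j.
Proof.
elim: c v j => [p|t||||c2 IH2 c1 IH1|c1 IH1 c2 IH2] v j //=.
- by case: j.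
- by case: j => [|[]].
- by case: j => [|[]].
- by case/and3P=> w2 w1 /eqP e h; rewrite IH2 ?e // IH1.
- case/andP=> w1 w2 h; rewrite ltnNge (leq_trans (leq_addr _ _) h) /=.
  rewrite IH2 //; last by lia.
  by congr v; lia.
Qed.

Lemma act_eq_in c v v' : wf c -> (forall j, (j < arity c)%N -> v j = v' j) ->
  forall j, (j < arity c)%N -> act c v j = act c v' j.
Proof.
elim: c v v' => [p|t||||c2 IH2 c1 IH1|c1 IH1 c2 IH2] v v' //=.
- by move=> _ h [|j] // _; rewrite h.
- by move=> _ h [|[|j]] // _; rewrite !h.
- by move=> _ h [|[|j]] // _; rewrite !h.
- case/and3P=> w2 w1 /eqP e h j hj; apply: IH2; rewrite ?e //.
  by move=> k hk; apply: IH1.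
- case/andP=> w1 w2 h j hj; case: ltnP => hj1.
    by apply: IH1 => // k hk; apply: h; lia.
  by apply: IH2 => //; [move=> k hk; apply: h; lia | lia].
Qed.

Lemma conform_mx_sum m n (A : 'M[R[i]]_m) v i (lt_im : (i < m)%N) (lt_in : (i < n)%N) :
  m = n ->
  \sum_(j < n) (conform_mx (0 : 'M_n) A) (Ordinal lt_in) j * v j =
  \sum_(j < m) A (Ordinal lt_im) j * v j.
Proof.
move=> e; case: n / e lt_in => lt_in; rewrite conform_mx_id.
by apply: eq_bigr => j _; congr (A _ j * _); apply: val_inj.
Qed.

Lemma sem_act c v i (lt_i : (i < arity c)%N) : wf c ->
  act c v i = \sum_j sem c (Ordinal lt_i) j * v j.
Proof.
elim: c v i lt_i => [p|t||||c2 IH2 c1 IH1|c1 IH1 c2 IH2] v i lt_i //=.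
- move=> _; rewrite big_ord1; case: i lt_i => // lt_i.
  by rewrite !mxE /=.
- move=> _; rewrite !big_ord_recl big_ord0 !mxE /=.
  by case: i lt_i => [|[|i]] //= lt_i; rewrite addr0.
- move=> _; rewrite big_ord1; case: i lt_i => // lt_i.
  by rewrite !mxE /= mul1r.
- move=> _; rewrite !big_ord_recl big_ord0 !mxE /=.
  by case: i lt_i => [|[|i]] //= lt_i; rewrite ?mul0r ?mul1r ?addr0 ?add0r.
- case/and3P=> w2 w1 /eqP e.
  have lt_i2 : (i < arity c2)%N by rewrite e.
  rewrite (IH2 _ _ lt_i2 w2).
  under [RHS]eq_bigr => j _ do rewrite mxE mulr_suml.
  rewrite exchange_big /=.
  rewrite -(conform_mx_sum _ _ lt_i2 lt_i e).
  apply: eq_bigr => j _; under [RHS]eq_bigr => k _ do rewrite -mulrA.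
  rewrite -mulr_sumr; congr (_ * _).
  by case: j => j lt_j /=; rewrite (IH1 _ _ lt_j).
- case/andP=> w1 w2; rewrite big_split_ord /=.
  case: ltnP => hi.
    have -> : Ordinal lt_i = lshift _ (Ordinal hi) by apply: val_inj.
    rewrite [X in _ = _ + X]big1 ?addr0 => [|j _]; last first.
      by rewrite block_mxEur mxE mul0r.
    rewrite (IH1 _ _ hi w1); apply: eq_bigr => j _.
    by rewrite block_mxEul.
  have hi2 : (i - arity c1 < arity c2)%N by move: (lt_i) => /=; lia.
  have -> : Ordinal lt_i = rshift _ (Ordinal hi2) by apply: val_inj; rewrite /= subnKC.
  rewrite [X in _ = X + _]big1 ?add0r => [|j _]; last first.
    by rewrite block_mxEdl mxE mul0r.
  rewrite (IH2 _ _ hi2 w2); apply: eq_bigr => j _.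
  by rewrite block_mxEdr.
Qed.

Lemma semn_act n c v (i : 'I_n) : nmode n c ->
  act c v i = \sum_j semn n c i j * v j.
Proof.
case=> w e; rewrite /semn; case: i => i lt_i.
have lt_ic : (i < arity c)%N by rewrite e.
by rewrite (conform_mx_sum _ _ lt_ic) //= (sem_act _ lt_ic).
Qed.

(** A column is the image of a basis vector, so concrete entries can be obtained by computing
    [act]. *)
Lemma semnE n c (i j : 'I_n) : nmode n c ->
  semn n c i j = act c (fun k => (k == j :> nat)%:R) i.
Proof.
move=> h; rewrite semn_act // (bigD1 j) //= eqxx mulr1 big1 ?addr0 // => k.
by rewrite -val_eqE /= => /negbTE->; rewrite mulr0.
Qed.

(** On indices at least [n] both actions are the identity by [act_out], so comparing actions on
    infinite families compares nothing beyond the matrices. *)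
Lemma semn_actP n c1 c2 : nmode n c1 -> nmode n c2 ->
  semn n c1 = semn n c2 <-> act c1 = act c2.
Proof.
move=> h1 h2; split=> e; last by apply/matrixP => i j; rewrite !semnE // e.
apply/funext => v; apply/funext => i; case: (ltnP i n) => hi.
  by rewrite (semn_act v (Ordinal hi) h1) (semn_act v (Ordinal hi) h2) e.
by case: h1 h2 => w1 a1 [w2 a2]; rewrite !act_out ?a1 ?a2.
Qed.

Lemma arity_idk k : arity (idk R k) = k.
Proof. by elim: k => //= k ->; rewrite addn1. Qed.

Lemma wf_idk k : wf (idk R k).
Proof. by elim: k => //= k ->. Qed.

Lemma act_idk k v : act (idk R k) v = v.
Proof.
elim: k v => //= k IH v; apply/funext => j; rewrite arity_idk IH.
by case: ltnP => // h; congr v; lia.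
Qed.

Lemma arity_sigma k : arity (sigma R k) = k.+1.
Proof. by elim: k => //= k ->. Qed.

Lemma wf_sigma k : wf (sigma R k).
Proof. by elim: k => //= k ->; rewrite wf_idk arity_idk arity_sigma /=. Qed.

Lemma act_sigma k v : act (sigma R k) v =
  fun j => if j is j'.+1 then if (j <= k)%N then v j' else v j else v k.
Proof.
elim: k v => [|k IH] v; apply/funext => j /=; first by case: j.
case: ltnP => [|hj]; last first.
  rewrite act_idk IH; case: j hj => [|[|j]] // _.
  have -> : (2 + (j.+2 - 2) = j.+2)%N by lia.
  by rewrite /= subn1 /= ltnS; case: ifP => _; congr v; lia.
by case: j => [|[|j]] //= _; rewrite IH.
Qed.

(** Serves the soundness induction: in a transitivity step the middle circuit must inherit
    well-formedness, and the action of [cpar] depends on the arity of its upper factor. *)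
Lemma lopp_nmode c1 c2 : lopp c1 c2 -> wf c1 = wf c2 /\ arity c1 = arity c2.
Proof.
elim=> {c1 c2} //=.
- by move=> c c' _ [-> ->].
- by move=> ? ? ? _ [-> ->] _ [-> ->].
- by move=> ? ? ? ? _ [-> ->] _ [-> ->].
- by move=> ? ? ? ? _ [-> ->] _ [-> ->].
- by move=> k c [-> e]; rewrite wf_idk arity_idk e eqxx.
- by move=> k c [-> e]; rewrite wf_idk arity_idk e eqxx.
- by move=> ? ? ? -> -> -> -> -> /=; rewrite !eqxx.
- by move=> c ->; rewrite addn0 andbT.
- by move=> ? ? ? -> -> ->; rewrite addnA.
- by move=> ? ? ? ? -> -> -> -> -> -> /=; rewrite !eqxx.
- by move=> k c [-> e]; rewrite wf_sigma arity_sigma e addn1 add1n eqxx.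
Qed.

Lemma lopp_act c1 c2 : lopp c1 c2 -> wf c1 -> act c1 = act c2.
Proof.
elim=> {c1 c2}.
- by [].
- by move=> /= c c' /lopp_nmode[-> _] IH /IH->.
- by move=> /= ? ? ? /lopp_nmode[e _] IH1 _ IH2 w; rewrite IH1 // IH2 // -e.
- by move=> /= ? ? ? ? _ IH1 _ IH2 /and3P[w2 w1 _]; rewrite IH1 // IH2.
- by move=> /= ? ? ? ? l1 IH1 _ IH2 /andP[w2 w1]; rewrite IH1 // IH2 // (lopp_nmode l1).2.
- by move=> /= k c _ _; apply/funext => v; rewrite act_idk.
- by move=> /= k c _ _; apply/funext => v; rewrite act_idk.
- by [].
- by move=> /= c w _; apply/funext => v; apply/funext => j; rewrite subn0.
- move=> /= c w _; apply/funext => v; apply/funext => j; case: ltnP => // h.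
  by rewrite act_out //; congr v; lia.
- move=> /= c1 c2 c3 w1 w2 w3 _; apply/funext => v; apply/funext => j.
  case: ltnP => h; case: ltnP => h' //; try lia.
    by rewrite ifT //; lia.
  rewrite ifF; last by lia.
  congr act; last by lia.
  by apply/funext=> i; rewrite addnA.
- move=> /= c1 c2 c3 c4 w1 w2 w3 w4 e1 e3 _; apply/funext => v; apply/funext => j.
  rewrite -e1; case: ltnP => h.
    by apply: act_eq_in; rewrite -?e1 // => k ->.
  congr act; apply/funext => i; rewrite ltnNge leq_addr /=.
  by congr act; lia.
- move=> /= k c [w e] _; apply/funext => v; rewrite !act_sigma.
  apply/funext => j; rewrite e.
  case: j => [|j] /=; first by rewrite ltnn subnn addn0.
  rewrite subn1 /=; case: ltnP => h.
    by apply: act_eq_in; rewrite ?e // => i hi; rewrite add1n hi.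
  rewrite [RHS]act_out ?e // !ifF; try lia.
  by congr v; lia.
- by move=> /= _; apply/funext => v; apply/funext => -[|[|j]].
- move=> /= _; apply/funext => v; apply/funext => -[|j] //=.
  by rewrite /expi cos0 sin0 mul1r.
- move=> /= _; apply/funext => v; apply/funext => -[|j] //=.
  by rewrite /expi mulr_natl cos2pi sin2pi mul1r.
- move=> /= _; apply/funext => v; apply/funext => j.
  by case: j => [|[|[|j]]] //=; rewrite ?cos0 ?sin0 ?mul1r ?mul0r
    ?addr0 ?add0r //; congr v; lia.
- move=> /= _; apply/funext => v; apply/funext => j.
  (* The phases of (C) cancel the factor [i] that [bs (pi / 2)] puts on the swap. *)
  have h : expi (- (pi / 2)) * (0 +i* 1) = 1 :> R[i].
    by rewrite /expi cosN sinN cos_pihalf sin_pihalf; simpc.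
  case: j => [|[|[|j]]] //=; rewrite ?cos_pihalf ?sin_pihalf ?mul0r
    ?addr0 ?add0r ?mulrA ?h ?mul1r //.
- move=> /= p1 p2 _; apply/funext => v; apply/funext => -[|j] //=.
  rewrite mulrA; congr (_ * _); rewrite /expi cosD sinD; simpc.
  by congr (_ +i* _); ring.
- move=> /= t p _; apply/funext => v; apply/funext => -[|[|[|j]]] //=; ring.
- by move=> > [_ [_ [_ /semn_actP e]]] _; apply: e.
- by move=> > [_ [_ [_ [_ [_ [_ /semn_actP e]]]]]] _; apply: e.
Qed.

End Action.

(** * Existence of the angles of axioms (F) and (G) *)

Section Angles.
Variable R : realType.
Local Notation cj := (@conjc R).
Implicit Types (a b c d z : R[i]) (t : R).

Lemma in0pi_in02pi t : in0pi t -> in02pi t.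
Proof. by rewrite /in0pi /in02pi; have := pi_gt0 R; lra. Qed.

Lemma in0pi0 : in0pi (0 : R).
Proof. by rewrite /in0pi lexx pi_gt0. Qed.

Lemma conjcM (x y : R[i]) : cj (x * y) = cj x * cj y.
Proof. exact: rmorphM. Qed.

Lemma conj_expi t : cj (expi t) = expi (- t).
Proof. by rewrite /expi cosN sinN. Qed.

Lemma expiNK t : expi (- t) * expi t = 1.
Proof.
rewrite -conj_expi /expi; simpc; rewrite -!expr2 cos2Dsin2.
by congr (_ +i* _); ring.
Qed.

Lemma cosC2 t : (cos t)%:C * (cos t)%:C - (0 +i* sin t) * (0 +i* sin t) = 1 :> R[i].
Proof. by simpc; rewrite -!expr2 cos2Dsin2. Qed.

Definition sqn z : R := complex.Re z ^+ 2 + complex.Im z ^+ 2.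

Lemma sqnE z : z * cj z = (sqn z)%:C.
Proof. by case: z => x y; rewrite /sqn; simpc; congr (_ +i* _); rewrite /=; ring. Qed.

Lemma sqnM z z' : sqn (z * z') = sqn z * sqn z'.
Proof. by case: z z' => x y [x' y']; rewrite /sqn; simpc => /=; ring. Qed.

Lemma sqn_real (x : R) : sqn x%:C = x ^+ 2.
Proof. by rewrite /sqn /= expr0n addr0. Qed.

Lemma sqn_expi t : sqn (expi t) = 1.
Proof. exact: cos2Dsin2. Qed.

Lemma sqn_ge0 z : 0 <= sqn z.
Proof. by rewrite addr_ge0 ?sqr_ge0. Qed.

Lemma sqn_eq0 z : sqn z = 0 -> z = 0.
Proof.
case: z => x y /eqP; rewrite /sqn /= paddr_eq0 ?sqr_ge0 // !sqrf_eq0.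
by case/andP => /eqP-> /eqP->.
Qed.

Lemma sqn_eq1_expi z : sqn z = 1 -> exists2 t, in02pi t & z = expi t.
Proof.
case: z => x y; rewrite /sqn /= => e; have p0 := pi_gt0 R.
have hx : -1 <= x <= 1 by have := sqr_ge0 y; nra.
have e2 : 1 - x ^+ 2 = y ^+ 2 by rewrite -e; ring.
have a0 := acos_ge0 hx; have ap := acos_lepi hx.
have cx : cos (acos x) = x by apply: acosK; rewrite in_itv.
have sx : sin (acos x) = `|y| by rewrite sin_acos // e2 sqrtr_sqr.
case: (leP 0 y) => y0.
  exists (acos x); first by rewrite /in02pi; lra.
  by rewrite /expi cx sx ger0_norm.
exists (pi *+ 2 - acos x).
  (* This keeps the angle strictly below [2 * pi]; [acos x = 0] would force [y = 0]. *)
  have : acos x != 0.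
    apply: contraTneq y0 => a1; rewrite -leNgt.
    have /eqP : `|y| = 0 by rewrite -sx a1 sin0.
    by rewrite normr_eq0 => /eqP->.
  by rewrite /in02pi -mulr_natl => ?; lra.
by rewrite addrC /expi cosD2pi sinD2pi cosN sinN cx sx ltr0_norm // opprK.
Qed.

(** The radius [r] may be negative: an angle in [[pi, 2 * pi)] is lowered by [pi] and the sign goes
    into [r]. The clause on [r = 0] provides the normalisation of a phase next to a vanishing
    cosine. *)
Lemma polar z : exists (r t : R),
  [/\ in0pi t, z = r%:C * expi t, r = 0 -> t = 0 & r ^+ 2 = sqn z].
Proof.
case: (eqVneq z 0) => [->|z0].
  by exists 0, 0; rewrite mul0r sqn_real; split=> //; exact: in0pi0.
have n0 : 0 < sqn z.
  by rewrite lt_def sqn_ge0 andbT; apply: contra_neq z0; apply: sqn_eq0.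
pose m := Num.sqrt (sqn z).
have m0 : 0 < m by rewrite sqrtr_gt0.
have m2 : m ^+ 2 = sqn z by rewrite sqr_sqrtr // ltW.
have mC : m%:C != 0 :> R[i] by rewrite fmorph_eq0 gt_eqF.
have [t ht et] : exists2 t, in02pi t & z / m%:C = expi t.
  apply: sqn_eq1_expi; rewrite sqnM -fmorphV sqn_real exprVn m2 mulfV //.
  by rewrite gt_eqF.
have ez : z = m%:C * expi t by rewrite -et mulrC divfK.
case: (ltP t pi) => tp.
  exists m, t; split=> //; last by move=> e; rewrite e ltxx in m0.
  by move: ht; rewrite /in02pi /in0pi tp andbT => /andP[].
exists (- m), (t - pi); split.
- by move: ht; rewrite /in02pi /in0pi; lra.
- rewrite ez (_ : expi t = - expi (t - pi)) ?rmorphN ?mulrN ?mulNr //.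
  by rewrite -{1}[t](subrK pi) /expi cosDpi sinDpi; simpc.
- by move/eqP; rewrite oppr_eq0 gt_eqF.
- by rewrite sqrrN.
Qed.

(** If [b] is nonzero, [b3] is the phase of [b] divided by [i], and [sin b2] is the modulus of [b],
    hence positive. The signed polar form of [expi (- b3) * a] then gives [cos b2] and [b1]. *)
Lemma unit_row2 a b : sqn a + sqn b = 1 -> exists b1 b2 b3 : R,
  [/\ in0pi b1, in0pi b2 & in02pi b3] /\
  [/\ (b2 = 0 \/ b2 = pi / 2) -> b1 = 0,
      a = expi b3 * (expi b1 * (cos b2)%:C) & b = expi b3 * (0 +i* sin b2)].
Proof.
move=> e; case: (eqVneq b 0) => [b0|bn0].
  move: e; rewrite b0 {2}/sqn /= !expr0n !addr0 => /sqn_eq1_expi[t ht ->].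
  exists 0, 0, t; do !split=> //; try exact: in0pi0.
    by rewrite /expi !cos0 sin0 !mulr1.
  by rewrite sin0 mulr0.
have n0 : 0 < sqn b.
  by rewrite lt_def sqn_ge0 andbT; apply: contra_neq bn0; apply: sqn_eq0.
pose m := Num.sqrt (sqn b).
have m0 : 0 < m by rewrite sqrtr_gt0.
have m2 : m ^+ 2 = sqn b by rewrite sqr_sqrtr // ltW.
have imn0 : (0 +i* m) != 0 :> R[i].
  by apply/eqP => -[me]; rewrite me ltxx in m0.
have [b3 h3 e3] : exists2 t, in02pi t & b / (0 +i* m) = expi t.
  apply: sqn_eq1_expi.
  have : sqn (b / (0 +i* m)) * sqn (0 +i* m) = sqn b by rewrite -sqnM divfK.
  rewrite {2}/sqn /= expr0n add0r m2 => /(canRL (mulfK _)) -> //;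
    rewrite ?mulfV // gt_eqF //.
have eb : b = expi b3 * (0 +i* m) by rewrite -e3 divfK.
have [r [b1 [h1 er r0 r2]]] := polar (expi (- b3) * a).
rewrite sqnM sqn_expi mul1r in r2.
have hr : -1 <= r <= 1 by have := sqr_ge0 m; nra.
have cx : cos (acos r) = r by apply: acosK; rewrite in_itv.
have sx : sin (acos r) = m.
  rewrite sin_acos // r2 -[m](ger0_norm (ltW m0)) -sqrtr_sqr m2.
  by congr Num.sqrt; lra.
exists b1, (acos r), b3; split; split=> //.
- rewrite /in0pi acos_ge0 //= lt_def acos_lepi // andbT.
  by apply/eqP => ep; move: m0; rewrite -sx -ep sinpi ltxx.
- case=> h; first by move: m0; rewrite -sx h sin0 ltxx.
  by apply: r0; rewrite -cx h cos_pihalf.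
- by rewrite cx [expi b1 * _]mulrC -er mulrA [expi b3 * _]mulrC expiNK mul1r.
- by rewrite sx.
Qed.

(** The first row fixes [b1], [b2], [b3]. The vectors orthogonal to it form a complex line, so the
    second row is a unit multiple of a known unit vector, and that multiple is [expi b4]. *)
Lemma unitary2_angles a b c d :
  a * cj a + b * cj b = 1 -> c * cj c + d * cj d = 1 ->
  c * cj a + d * cj b = 0 ->
  exists b1 b2 b3 b4 : R,
  [/\ in0pi b1, in0pi b2, in02pi b3, in02pi b4 &
      (b2 = 0 \/ b2 = pi / 2) -> b1 = 0] /\
  [/\ a = expi b3 * (expi b1 * (cos b2)%:C), b = expi b3 * (0 +i* sin b2),
      c = expi b4 * (expi b1 * (0 +i* sin b2)) & d = expi b4 * (cos b2)%:C].
Proof.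
rewrite !sqnE -!rmorphD /= => /complexI e1 /complexI e2 e0.
have [b1 [b2 [b3 [[h1 h2 h3] [h12 ea eb]]]]] := unit_row2 e1.
have cs := cosC2 b2.
have conjS : cj (0 +i* sin b2) = - (0 +i* sin b2) :> R[i] by simpc.
have conjC : cj ((cos b2)%:C) = (cos b2)%:C :> R[i] by simpc.
have n3 : expi (- b3) != 0.
  by apply/eqP => z; have := expiNK b3; rewrite z mul0r => /eqP; rewrite eq_sym oner_eq0.
rewrite ea eb !conjcM conjS conjC !conj_expi in e0.
have E1 := expiNK b1.
have sS : sqn (0 +i* sin b2) = sin b2 ^+ 2 by rewrite /sqn /= expr0n add0r.
have sC := sqn_real (cos b2); have sE := sqn_expi b1.
suff [b4 h4 [ec ed]] : exists2 b4, in02pi b4 &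
    c = expi b4 * (expi b1 * (0 +i* sin b2)) /\ d = expi b4 * (cos b2)%:C.
  by exists b1, b2, b3, b4.
move: E1 cs sS sC sE e0 {ea eb conjS conjC}.
(* What follows is polynomial algebra modulo [E' * E = 1] and [C * C - S * S = 1]. *)
move: ((cos b2)%:C) (0 +i* sin b2) (expi (- b1)) (expi b1) => C S E' E E1 cs sS sC sE e0.
have e4 : E' * C * c = S * d.
  apply/eqP; rewrite -subr_eq0 -(mulIr_eq0 _ (mulIf n3)); apply/eqP.
  by rewrite -[RHS]e0; ring.
(* The Hermitian product of [(c, d)] with [(E * S, C)], the conjugate of [S] being [- S]. *)
pose l := C * d - S * E' * c.
have lc : l * (E * S) = c.
  transitivity (S * E * (C * d) - S * S * (E' * E) * c); first by rewrite /l; ring.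
  rewrite E1 mulr1 (_ : S * E * (C * d) = C * E * (S * d)); last by ring.
  rewrite -e4 -[RHS]mul1r -cs (_ : C * E * (E' * C * c) = C * C * (E' * E) * c); last by ring.
  by rewrite E1; ring.
have ld : l * C = d.
  transitivity (C * C * d - S * (E' * C * c)); first by rewrite /l; ring.
  by rewrite e4 -[RHS]mul1r -cs; ring.
have [b4 h4 e5] : exists2 t, in02pi t & l = expi t.
  apply: sqn_eq1_expi; move: e2; rewrite -{1}lc -{1}ld !sqnM sE mul1r sS sC.
  by rewrite -mulrDr addrC cos2Dsin2 mulr1.
by exists b4; rewrite -?e5 ?lc ?ld.
Qed.

(** Two uses of [unit_row2]: first on [(b, c)] scaled to norm 1, then on [a] paired with the norm of
    [(b, c)]. The degenerate case [b = c = 0] takes all angles but [d7] to be 0. *)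
Lemma unit_row3 a b c : sqn a + sqn b + sqn c = 1 ->
  exists d1 d2 d3 d4 d7 : R,
  [/\ in0pi d1, in0pi d2, in0pi d3, in0pi d4 & in02pi d7] /\
  [/\ (d3 = 0 \/ d3 = pi / 2) -> d1 = 0, (d4 = 0 \/ d4 = pi / 2) -> d2 = 0
    & d4 = 0 -> d3 = 0] /\
  [/\ a = expi d7 * ((cos d4)%:C * expi d2),
      b = expi d7 * ((0 +i* sin d4) * ((cos d3)%:C * expi d1)) &
      c = expi d7 * ((0 +i* sin d4) * (0 +i* sin d3))].
Proof.
move=> e; case: (eqVneq (sqn b + sqn c) 0) => [/eqP|n0].
  rewrite paddr_eq0 ?sqn_ge0 // => /andP[/eqP b0 /eqP c0].
  move: e; rewrite b0 c0 !addr0 => /sqn_eq1_expi[t ht ->].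
  rewrite (sqn_eq0 b0) (sqn_eq0 c0).
  exists 0, 0, 0, 0, t; do !split=> //; try exact: in0pi0.
  - by rewrite /expi !cos0 sin0 !mulr1.
  - by rewrite sin0 mul0r mulr0.
  - by rewrite sin0 mul0r mulr0.
have p0 : 0 < sqn b + sqn c by rewrite lt_def n0 addr_ge0 ?sqn_ge0.
pose m := Num.sqrt (sqn b + sqn c).
have m0 : 0 < m by rewrite sqrtr_gt0.
have m2 : m ^+ 2 = sqn b + sqn c by rewrite sqr_sqrtr // ltW.
have mC : m%:C != 0 :> R[i] by rewrite fmorph_eq0 gt_eqF.
have [|d1 [d3 [t [[h1 h3 ht] [h13 eb ec]]]]] := @unit_row2 (b / m%:C) (c / m%:C).
  by rewrite !sqnM -fmorphV sqn_real exprVn -mulrDl m2 mulfV.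
(* The phase [t] common to [b] and [c] is put into this entry, so that one global phase [d7]
   remains. *)
have [|d2 [d4 [d7 [[h2 h4 h7] [h24 ea em]]]]] := @unit_row2 a (m%:C * expi t).
  by rewrite sqnM sqn_expi sqn_real mulr1 m2 addrA.
exists d1, d2, d3, d4, d7; do !split=> //.
(* Here [d4 = 0] is impossible, since it would make [m%:C * expi t] vanish. *)
- move=> d0; move: em; rewrite d0 sin0 mulr0 => /eqP.
  rewrite mulf_eq0 (negbTE mC) /= => /eqP z; have := expiNK t.
  by rewrite z mulr0 => /eqP; rewrite eq_sym oner_eq0.
- by rewrite ea; ring.
- rewrite mulrA -em -[b](divfK mC) eb; ring.
- by rewrite mulrA -em -[c](divfK mC) ec; ring.
Qed.

(** * Unitarity of the semantics and solvability of (F) and (G) *)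

Definition adjmx m n (A : 'M[R[i]]_(m, n)) : 'M[R[i]]_(n, m) := \matrix_(i, j) cj (A j i).

Lemma adjmxM m n p (A : 'M[R[i]]_(m, n)) (B : 'M[R[i]]_(n, p)) :
  adjmx (A *m B) = adjmx B *m adjmx A.
Proof.
apply/matrixP => i j; rewrite !mxE rmorph_sum; apply: eq_bigr => k _.
by rewrite !mxE rmorphM mulrC.
Qed.

Lemma adjmxK m n (A : 'M[R[i]]_(m, n)) : adjmx (adjmx A) = A.
Proof. by apply/matrixP => i j; rewrite !mxE; case: (A i j) => x y /=; rewrite opprK. Qed.

Lemma semn_seq n (c1 c2 : circ R) : nmode n c1 -> nmode n c2 ->
  semn n (cseq c2 c1) = semn n c2 *m semn n c1.
Proof.
move=> h1 h2; have h : nmode n (cseq c2 c1).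
  by case: h1 h2 => w1 a1 [w2 a2]; rewrite /nmode /= w1 w2 a1 a2 eqxx.
apply/matrixP => i j; rewrite semnE // mxE /= semn_act //.
by apply: eq_bigr => k _; rewrite [semn n c1 _ _]semnE.
Qed.

(** The generators are unitary, and products and direct sums preserve this. It supplies the
    orthonormal rows from which the angles are computed. *)
Lemma sem_unitary (c : circ R) : wf c -> sem c *m adjmx (sem c) = 1%:M.
Proof.
elim: c => [p|t||||c2 IH2 c1 IH1|c1 IH1 c2 IH2].
- move=> _; apply/matrixP => i j; rewrite !ord1 !mxE big_ord1 !mxE eqxx !mulr1n /=.
  by rewrite sqnE sqn_expi.
- move=> _; apply/matrixP => i j; rewrite !mxE !big_ord_recl big_ord0 !mxE /=.
  have h := cos2Dsin2 t.
  case: i => -[|[|i]] //= hi; case: j => -[|[|j]] //= hj; rewrite !addr0 /=; simpc;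
    rewrite -?expr2 ?h ?[sin t ^+ 2 + _]addrC ?h; congr (_ +i* _); ring.
- by move=> _; apply/matrixP => i j; rewrite !ord1 !mxE big_ord1 !mxE /=; simpc.
- move=> _; apply/matrixP => i j; rewrite !mxE !big_ord_recl big_ord0 !mxE /=.
  case: i => -[|[|i]] //= hi; case: j => -[|[|j]] //= hj; rewrite !addr0 /=; simpc => //.
- by move=> _; apply/matrixP => -[].
- move=> /= /and3P[w2 w1 /eqP e]; move: (IH1 w1) (IH2 w2).
  move: (sem c2) (sem c1); case: _ / e => A2 A1 H1 H2; rewrite conform_mx_id adjmxM.
  by rewrite mulmxA -(mulmxA A2) H1 mulmx1.
- move=> /= /andP[/IH1 H1 /IH2 H2].
  have -> : adjmx (block_mx (sem c1) 0 0 (sem c2)) =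
      block_mx (adjmx (sem c1)) 0 0 (adjmx (sem c2)).
    apply/matrixP => k l; rewrite -[k]splitK -[l]splitK.
    case: (split k) => k'; case: (split l) => l' /=;
    by rewrite mxE ?block_mxEul ?block_mxEur ?block_mxEdl ?block_mxEdr !mxE ?conjc0.
  rewrite mulmx_block !mul0mx !mulmx0 !addr0 !add0r H1 H2.
  by rewrite -scalar_mx_block.
Qed.

Lemma semn_unitary n (c : circ R) : nmode n c -> semn n c *m adjmx (semn n c) = 1%:M.
Proof. by case=> w <-; rewrite /semn conform_mx_id sem_unitary. Qed.

Lemma ord2P (Q : 'I_2 -> Prop) : Q 0 -> Q 1 -> forall i, Q i.
Proof.
move=> q0 q1 i; suff [->|->] : i = 0 \/ i = 1 by [].
by case: i => -[|[|i]] // hi; [left|right]; exact: val_inj.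
Qed.

Lemma F_exists (a1 a2 a3 : R) : exists b1 b2 b3 b4 : R, F_angles a1 a2 a3 b1 b2 b3 b4.
Proof.
have hl : nmode 2 (F_lhs a1 a2 a3) by [].
have := semn_unitary hl; move dU: (semn 2 _) => U eU.
have en i j : U i 0 * cj (U j 0) + U i 1 * cj (U j 1) = (i == j)%:R.
  have := congr1 (fun M : 'M_2 => M i j) eU.
  rewrite !mxE !big_ord_recl big_ord0 !mxE addr0.
  by rewrite (_ : lift ord0 ord0 = 1) //; apply: val_inj.
have [b1 [b2 [b3 [b4 [[h1 h2 h3 h4 h12] [e1 e2 e3 e4]]]]]] :=
  unitary2_angles (en 0 0) (en 1 1) (en 1 0).
exists b1, b2, b3, b4; split; first by do !split; try exact: in0pi_in02pi.
split; first by split.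
split; first exact: h12.
rewrite dU; apply/matrixP; apply: ord2P; apply: ord2P;
  (rewrite [RHS]semnE; last by []); rewrite ?e1 ?e2 ?e3 ?e4 /=; ring.
Qed.

Lemma sum_ord3 (F : 'I_3 -> R[i]) : \sum_i F i = F 0 + F 1 + F ord_max.
Proof.
rewrite !big_ord_recl big_ord0 addr0 addrA; congr (F _ + F _ + F _);
exact: val_inj.
Qed.

Lemma ord3P (Q : 'I_3 -> Prop) : Q 0 -> Q 1 -> Q ord_max -> forall i, Q i.
Proof.
move=> q0 q1 q2 i.
suff [->|->|->] : [\/ i = 0, i = 1 | i = ord_max] by [].
case: i => -[|[|[|i]]] // hi; [constructor 1|constructor 2|constructor 3];
exact: val_inj.
Qed.

(** The first row of the left-hand matrix [U] determines a circuit [Wc] with the same first row.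
    Then [U] times the adjoint of [W] is 1 on mode 0 and a 2 by 2 unitary block on the other modes,
    which yields [d5], [d6], [d8], [d9]. *)
Lemma G_exists (g1 g2 g3 g4 : R) : exists d1 d2 d3 d4 d5 d6 d7 d8 d9 : R,
  G_angles g1 g2 g3 g4 d1 d2 d3 d4 d5 d6 d7 d8 d9.
Proof.
have hl : nmode 3 (G_lhs g1 g2 g3 g4) by [].
have := semn_unitary hl; move dU: (semn 3 _) => U eU.
have [|d1 [d2 [d3 [d4 [d7 [[h1 h2 h3 h4 h7] [[k1 k2 k3] [u0 u1 u2]]]]]]]] :=
  @unit_row3 (U 0 0) (U 0 1) (U 0 ord_max).
  have := congr1 (fun M : 'M_3 => M 0 0) eU.
  by rewrite mxE sum_ord3 !mxE !sqnE -!rmorphD => /complexI.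
pose Wc := cseq (Phi0 d7) (cseq (B01 d4) (cseq (B12 d3) (cseq (Phi0 d2) (Phi1 d1)))).
have hW : nmode 3 Wc by [].
pose W := semn 3 Wc.
have eW : W *m adjmx W = 1%:M := semn_unitary hW.
have rW j : W 0 j = U 0 j.
  move: j; apply: ord3P; (rewrite /W semnE; last by []);
    rewrite ?u0 ?u1 ?u2 /=; ring.
pose V := U *m adjmx W.
have eV : V *m adjmx V = 1%:M.
  rewrite /V adjmxM adjmxK mulmxA -(mulmxA U) (mulmx1C eW) mulmx1; exact: eU.
have eUV : U = V *m W by rewrite /V -mulmxA (mulmx1C eW) mulmx1.
have V0 j : V 0 j = (0 == j)%:R.
  have := congr1 (fun M : 'M_3 => M 0 j) eW; rewrite /V !mxE => <-.
  by apply: eq_bigr => l _; rewrite rW.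
have en i j : V i 0 * cj (V j 0) + V i 1 * cj (V j 1) +
    V i ord_max * cj (V j ord_max) = (i == j)%:R.
  by have := congr1 (fun M : 'M_3 => M i j) eV; rewrite mxE sum_ord3 !mxE.
(* The first row is the first basis vector, so the product of row [i] with it is the entry
   [V i 0]. *)
have Vi0 i : V i 0 = (i == 0)%:R.
  have := en i 0; by rewrite !V0 !conjc_nat /= mulr1 !mulr0 !addr0.
have [||| d5 [d6 [d8 [d9 [[h5 h6 h8 h9 k6] [e1 e2 e3 e4]]]]]] :=
  @unitary2_angles (V 1 1) (V 1 ord_max) (V ord_max 1) (V ord_max ord_max).
- by have := en 1 1; rewrite !Vi0 /= mul0r add0r.
- by have := en ord_max ord_max; rewrite !Vi0 /= mul0r add0r.
- by have := en ord_max 1; rewrite !Vi0 /= mul0r add0r.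
pose Xc := cseq (Phi2 d9) (cseq (Phi1 d8) (cseq (B12 d6) (Phi1 d5))).
have hX : nmode 3 Xc by [].
have eX : V = semn 3 Xc.
  apply/matrixP; apply: ord3P; apply: ord3P;
  (rewrite [RHS]semnE; last by []); rewrite ?V0 ?Vi0 ?e1 ?e2 ?e3 ?e4 /=; ring.
exists d1, d2, d3, d4, d5, d6, d7, d8, d9; split.
  by move=> d; rewrite !inE => /or4P[| | |/or4P[| | |/or3P[]]] /eqP-> //; apply: in0pi_in02pi.
split; first by move=> d; rewrite !inE => /or4P[| | |/or3P[]] /eqP->.
split; first exact: k1.
split; first exact: k2.
split; first exact: k3.
split; first exact: k6.
(* The circuit [cseq Xc Wc] differs from [G_rhs] only in that [Phi0 d7] has passed [B12 d6] and
   [Phi1 d5], which leave mode 0 alone. *)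
rewrite dU eUV eX -(semn_seq hW hX).
apply/semn_actP; [by split|by split|].
apply/funext => v; apply/funext => j.
case: j => [|[|[|j]]] /=; rewrite ?(subn1, add1n, addn1, subSS, subn0) /=;
reflexivity.
Qed.

End Angles.

(** * Circuits as words of gates *)

#[local] Hint Resolve lopp_refl : core.

Section Words.
Variable R : realType.
Implicit Types (c : circ R) (i j k n : nat).

#[global] Instance lopp_Equivalence : Equivalence (@lopp R).
Proof.
split; [exact: lopp_refl|exact: lopp_sym|exact: lopp_trans].
Qed.

#[global] Instance cseq_Proper : Proper (@lopp R ==> @lopp R ==> @lopp R) (@cseq R).
Proof. by move=> c2 c2' h2 c1 c1' h1; apply: lopp_cseq. Qed.

#[global] Instance cpar_Proper : Proper (@lopp R ==> @lopp R ==> @lopp R) (@cpar R).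
Proof. by move=> c2 c2' h2 c1 c1' h1; apply: lopp_cpar. Qed.

Ltac wfa := rewrite /nmode /= ?wf_idk ?arity_idk //=; try (by split); try lia.

Lemma idk_add i j : lopp (cpar (idk R i) (idk R j)) (idk R (i + j)).
Proof.
elim: j => [|j IH]; first by rewrite addn0 /= ax_empr ?wf_idk.
by rewrite addnS /= -IH -ax_parA ?wf_idk.
Qed.

Lemma cpar_seq c1 c2 : wf c1 -> wf c2 ->
  lopp (cpar c1 c2)
       (cseq (cpar c1 (idk R (arity c2))) (cpar (idk R (arity c1)) c2)).
Proof.
move=> w1 w2; rewrite -ax_interchange ?wf_idk ?arity_idk //.
by rewrite ax_idl // ax_idr.
Qed.

Definition place i c k := cpar (idk R i) (cpar c (idk R k)).

Lemma wf_place i c k : wf (place i c k) = wf c.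
Proof. by rewrite /= !wf_idk andbT. Qed.

Lemma arity_place i c k : arity (place i c k) = (i + (arity c + k))%N.
Proof. by rewrite /= !arity_idk. Qed.

#[global] Instance place_Proper i : Proper (@lopp R ==> eq ==> @lopp R) (place i).
Proof. by move=> c c' h k _ <-; rewrite /place h. Qed.

Lemma place_seq i k c1 c2 : wf c1 -> wf c2 -> arity c1 = arity c2 ->
  lopp (place i (cseq c2 c1) k) (cseq (place i c2 k) (place i c1 k)).
Proof.
move=> w1 w2 e; rewrite /place -ax_interchange; try by wfa; rewrite ?w1 ?w2 ?e.
rewrite ax_idl; last by split; rewrite ?wf_idk ?arity_idk.
rewrite -ax_interchange; try by wfa.
by rewrite ax_idl; last by split; rewrite ?wf_idk ?arity_idk.
Qed.

Lemma place_idk i k m : lopp (place i (idk R m) k) (idk R (i + (m + k))).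
Proof. by rewrite /place !idk_add. Qed.

Lemma place0 c : wf c -> lopp (place 0 c 0) c.
Proof. by move=> w; rewrite /place ax_empl ?ax_empr //=; rewrite w. Qed.

Lemma place_par i k c1 c2 : wf c1 -> wf c2 ->
  lopp (place i (cpar c1 c2) k)
    (cseq (place i c1 (arity c2 + k)) (place (i + arity c1) c2 k)).
Proof.
move=> w1 w2; rewrite [X in place i X k]cpar_seq // place_seq;
  try by wfa; rewrite ?w1 ?w2.
rewrite /place -!idk_add !ax_parA //; try by wfa; rewrite ?w1 ?w2.
Qed.

Inductive gate := P of nat & R | B of nat & R.

Definition gpos g := match g with P i _ => i | B i _ => i end.

Definition gcirc g := match g with P _ p => ph p | B _ t => bs t end.

(* Gates that stick out of the [n] modes are read as the identity, so that
   every word denotes a well-formed [n]-mode circuit. *)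
Definition placeg n g : circ R :=
  let m := (gpos g + arity (gcirc g))%N in
  if (m <= n)%N then place (gpos g) (gcirc g) (n - m) else idk R n.

(** The head of a word is the gate applied last, as in the notation for composition. *)
Fixpoint cw n (w : seq gate) : circ R :=
  if w is g :: w' then cseq (placeg n g) (cw n w') else idk R n.

Lemma placeg_nmode n g : nmode n (placeg n g).
Proof.
rewrite /placeg /nmode; case: leqP => h; last by rewrite wf_idk arity_idk.
rewrite wf_place arity_place; split; first by case: g h.
by rewrite addnA subnKC.
Qed.

Lemma cw_nmode n w : nmode n (cw n w).
Proof.
elim: w => [|g w [IH1 IH2]] /=; rewrite /nmode ?wf_idk ?arity_idk //=.
by have [-> ->] := placeg_nmode n g; rewrite IH1 IH2 eqxx.
Qed.

Lemma cw_cat n w1 w2 : lopp (cw n (w1 ++ w2)) (cseq (cw n w1) (cw n w2)).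
Proof.
elim: w1 => [|g w1 IH] /=; first by rewrite ax_idl //; apply: cw_nmode.
have [[[a b] [c d]] [e f]] := (placeg_nmode n g, cw_nmode n w1, cw_nmode n w2).
by rewrite IH ax_seqA ?b ?d ?f.
Qed.

(* The swap is expanded by axiom (C). *)
Fixpoint tw i c : seq gate :=
  match c with
  | ph p => [:: P i p]
  | bs t => [:: B i t]
  | idw | emp => [::]
  | sw => [:: P i (- (pi / 2)); P i.+1 (- (pi / 2)); B i (pi / 2)]
  | cseq c2 c1 => tw i c2 ++ tw i c1
  | cpar c1 c2 => tw i c1 ++ tw (i + arity c1) c2
  end.

(** The padding is arbitrary because in a parallel composition each factor is padded by the modes of
    the other one. *)
Lemma place_tw n i k c : wf c -> n = (i + arity c + k)%N ->
  lopp (place i c k) (cw n (tw i c)).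
Proof.
have one j l p : n = (j + arity (gcirc p) + l)%N -> j = gpos p ->
    lopp (place j (gcirc p) l) (placeg n p).
  move=> -> ->; rewrite /placeg leq_addr.
  by have -> : (gpos p + arity (gcirc p) + l - (gpos p + arity (gcirc p)) = l)%N by lia.
have cw1 p : lopp (placeg n p) (cseq (placeg n p) (idk R n)).
  by rewrite ax_idr //; apply: placeg_nmode.
elim: c i k => [p|t||||c2 IH2 c1 IH1|c1 IH1 c2 IH2] i k /=.
- by move=> _ e; rewrite -cw1 -(one i k (P i p)).
- by move=> _ e; rewrite -cw1 -(one i k (B i t)).
- move=> _ ->; rewrite -addnA -(place_idk i k 1).
  by rewrite /= ax_empl.
- move=> _ e; rewrite ax_C place_seq // place_par //.
  rewrite /= ax_idr; last exact: placeg_nmode.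
  rewrite -(one i (1 + k)%N (P i _)) /=; try lia.
  rewrite -(one (i + 1)%N k (P i.+1 _)) /=; try lia.
  rewrite -(one i k (B i _)) /=; try lia.
  by rewrite ax_seqA // ?wf_place ?arity_place //=; lia.
- by move=> _ ->; rewrite addn0; apply: (place_idk i k 0).
- move=> /and3P[w2 w1 /eqP e] en.
  by rewrite place_seq // IH1 // IH2 ?e // cw_cat.
- move=> /andP[w1 w2] en; rewrite place_par // cw_cat IH1 ?IH2 //; lia.
Qed.

Definition weq n (w1 w2 : seq gate) := lopp (cw n w1) (cw n w2).

#[global] Instance weq_Equivalence n : Equivalence (weq n).
Proof.
split=> [w|w1 w2|w1 w2 w3]; first exact: lopp_refl.
- exact: lopp_sym.
- exact: lopp_trans.
Qed.

#[global] Instance cons_Proper n g : Proper (weq n ==> weq n) (cons g).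
Proof. by move=> w w' h; apply: lopp_cseq. Qed.

#[global] Instance cat_Proper n : Proper (weq n ==> weq n ==> weq n) (@cat gate).
Proof. by move=> w w' h v v' h'; rewrite /weq !cw_cat; apply: lopp_cseq. Qed.

Lemma lopp_tw c : wf c -> lopp c (cw (arity c) (tw 0 c)).
Proof. by move=> w; rewrite -(@place_tw _ 0%N 0%N) ?place0 // addn0. Qed.

(** Turns each axiom on circuits into a rewriting rule on words, at any height [i] and with any tail
    [w]. *)
Lemma weq_tw n i c c' : lopp c c' -> wf c -> (i + arity c <= n)%N ->
  forall w, weq n (tw i c ++ w) (tw i c' ++ w).
Proof.
move=> h w le v; have [w' a'] := lopp_nmode h.
apply: cat_Proper; last by reflexivity.
rewrite /weq -(@place_tw n i (n - (i + arity c)) c) //; last by lia.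
rewrite -(@place_tw n i (n - (i + arity c)) c') -?w' -?a' //; last by lia.
by apply: place_Proper.
Qed.

End Words.

#[local] Hint Extern 0 (weq _ _ _) => reflexivity : core.

(** * Staircase decomposition of words *)

Section Rules.
Variables (R : realType) (n : nat).
Implicit Types (i j k : nat) (w : seq (gate R)) (g h : gate R).

Definition gwidth g := arity (gcirc g).
Definition disj g h :=
  (gpos g + gwidth g <= gpos h)%N || (gpos h + gwidth h <= gpos g)%N.

(** Disposes of out-of-range gates, so that most rules below carry no bound on positions. *)
Lemma weq_out g w : (n < gpos g + gwidth g)%N -> weq n (g :: w) w.
Proof.
move=> h; rewrite /weq /= /placeg leqNgt h /=.
exact/ax_idl/cw_nmode.
Qed.

Lemma weq_P0 i w : weq n (P i 0 :: w) w.
Proof.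
case: (leqP (i + 1) n) => h; last exact: weq_out.
exact: (weq_tw (i := i) (ax_A0 R)).
Qed.

Lemma weq_PP i a b w : weq n [:: P i a, P i b & w] (P i (b + a) :: w).
Proof.
case: (leqP (i + 1) n) => h; last by rewrite !weq_out.
exact: (weq_tw (i := i) (ax_D b a)).
Qed.

Lemma weq_B0 i w : weq n (B i 0 :: w) w.
Proof.
case: (leqP (i + 2) n) => h; last exact: weq_out.
exact: (weq_tw (i := i) (ax_B R)).
Qed.

(** Both orders are interchange forms of one parallel circuit: [g], then [m] idle wires, then [h].
    Translation into words erases the idle wires. *)
Lemma weq_comm_lt g h w : (gpos g + gwidth g <= gpos h)%N ->
  weq n [:: g, h & w] [:: h, g & w].
Proof.
move=> le; case: (leqP (gpos h + gwidth h) n) => hn; last by rewrite !(@weq_out h).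
pose m := (gpos h - (gpos g + gwidth g))%N.
pose c2 := cpar (idk R m) (gcirc h).
have wg : wf (gcirc g) by case: g {le m c2}.
have wh : wf (gcirc h) by case: h {le hn m c2 wg}.
have w2 : wf c2 by rewrite /= wf_idk.
have a2 : arity c2 = (m + gwidth h)%N by rewrite /= arity_idk.
have l1 := cpar_seq wg w2.
have tid i l : tw i (idk R l) = [::].
  by elim: l i => //= l IH i; rewrite IH.
have tg i x : tw i (gcirc x) =
    [:: match x with P _ p => P i p | B _ p => B i p end] :> seq (gate R).
  by case: x.
have e : (gpos g + gwidth g + m = gpos h)%N by rewrite /m; lia.
have l2 : lopp (cpar (gcirc g) c2)
   (cseq (cpar (idk R (gwidth g)) c2) (cpar (gcirc g) (idk R (arity c2)))).
  rewrite -ax_interchange ?wf_idk ?arity_idk //.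
  by rewrite ax_idl ?ax_idr.
have := weq_tw (i := gpos g) (lopp_trans (lopp_sym l1) l2) (n := n).
rewrite /= !tg !tid /= !wf_idk !arity_idk eqxx wg wh /= => H.
have {}H := H erefl _ w; move: H; rewrite -/(gwidth g) -/(gwidth h) e.
clear -hn e; clearbody m; move: e hn.
by case: g => ? ?; case: h => ? ? /= e hn H; apply: H; rewrite /gwidth /= in e hn *; lia.
Qed.

Lemma weq_comm g h w : disj g h -> weq n [:: g, h & w] [:: h, g & w].
Proof. by case/orP => H; [|symmetry]; apply: weq_comm_lt. Qed.

Lemma weq_move g S w : all (disj g) S -> weq n (g :: S ++ w) (S ++ g :: w).
Proof.
elim: S => //= h S IH /andP[d /IH e].
by rewrite weq_comm // e.
Qed.

Lemma weq_swap w1 w2 w : all (fun g => all (disj g) w2) w1 ->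
  weq n (w1 ++ w2 ++ w) (w2 ++ w1 ++ w).
Proof.
elim: w1 => //= g w1 IH /andP[d /IH ->].
by rewrite weq_move.
Qed.

Lemma weq_E i t p w :
  weq n [:: B i t, P i p, P i.+1 p & w] [:: P i p, P i.+1 p, B i t & w].
Proof.
case: (leqP (i + 2) n) => h; last first.
  by rewrite !(@weq_out (B i t)).
by have := weq_tw (i := i) (ax_E t p) erefl h w; rewrite /= !addn1.
Qed.

(** Split [P i a] into [P i p] and [P i (a - p)]; the phase [p], now common to both modes, crosses
    the beam splitter by (E). *)
Lemma weq_E_left i t a p w :
  weq n [:: B i t, P i a, P i.+1 p & w]
        [:: P i p, P i.+1 p, B i t, P i (a - p) & w].
Proof.
rewrite -weq_E (@weq_comm (P i.+1 p) (P i (a - p))); last by rewrite /disj /gwidth /=; lia.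
by rewrite weq_PP subrK.
Qed.

(** Insert the cancelling phases [- p] and [p] on mode [i], then move the common phase [p] to the
    right by (E). *)
Lemma weq_E_right i t p w :
  weq n [:: P i.+1 p, B i t & w]
        [:: P i (- p), B i t, P i p, P i.+1 p & w].
Proof. by rewrite weq_E weq_PP subrr weq_P0. Qed.

Lemma weq_F i a1 a2 a3 b1 b2 b3 b4 w : (i + 2 <= n)%N ->
  F_angles a1 a2 a3 b1 b2 b3 b4 ->
  weq n [:: B i a3, P i a2, B i a1 & w]
        [:: P i b3, P i.+1 b4, B i b2, P i b1 & w].
Proof.
move=> h /ax_F H; have := weq_tw (i := i) H erefl h w.
by rewrite /= !addn1.
Qed.

Lemma weq_G i (g1 g2 g3 g4 : R) d1 d2 d3 d4 d5 d6 d7 d8 d9 w : (i + 3 <= n)%N ->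
  G_angles g1 g2 g3 g4 d1 d2 d3 d4 d5 d6 d7 d8 d9 ->
  weq n [:: B i g4, B i.+1 g3, P i g2, B i g1 & w]
        [:: P i.+2 d9, P i.+1 d8, P i d7, B i.+1 d6, P i.+1 d5,
            B i d4, B i.+1 d3, P i d2, P i.+1 d1 & w].
Proof.
move=> h /ax_G H; have := weq_tw (i := i) H erefl h w.
by rewrite /= !addn1 !addn2.
Qed.

(** * Supports of words and reduction to staircases *)

Definition supp k w := all (fun g => (k <= gpos g)%N) w.

Lemma supp_le k l w : (l <= k)%N -> supp k w -> supp l w.
Proof. by move=> le; apply: sub_all => g; apply: leq_trans. Qed.

Lemma supp_disj g k w : supp k w -> (gpos g + gwidth g <= k)%N -> all (disj g) w.
Proof.
move=> + le; apply: sub_all => h hk.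
by rewrite /disj (leq_trans le).
Qed.

(* The angles [b] are redundant for the image of the [k]-th basis vector; they
   absorb the extra phases produced by axioms (F) and (G). *)
Inductive stair : nat -> seq (gate R) -> Prop :=
  | stair_last k a : k.+1 = n -> stair k [:: P k a]
  | stair_step k a t b S : 0 <= t < pi -> stair k.+1 S ->
      stair k (P k a :: S ++ [:: B k t; P k b]).

Lemma stair_lt k S : stair k S -> (k < n)%N.
Proof. by elim=> {k S} [k a e|k a t b S _ _ lt]; lia. Qed.

Lemma stair_supp k S : stair k S -> supp k S.
Proof.
elim=> {k S} [k a _|k a t b S _ _ IH] /=; first by rewrite leqnn.
by rewrite /supp all_cat /= !leqnn !andbT; apply: supp_le IH.
Qed.

Lemma stair_triv k : (k < n)%N -> exists2 S, stair k S & weq n S [::].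
Proof.
move=> lt; have [m e] : exists m, n = (m + k.+1)%N by exists (n - k.+1)%N; lia.
elim: m k lt e => [|m IH] k lt e.
  by exists [:: P k 0]; [apply: stair_last | rewrite weq_P0].
have [||S sS eS] := IH k.+1; try lia.
exists (P k 0 :: S ++ [:: B k 0; P k 0]).
  by apply: stair_step => //; rewrite lexx pi_gt0.
by rewrite weq_P0 eS /= weq_B0 weq_P0.
Qed.

(** The rightmost gate of a staircase from [k] is a phase on mode [k], which merges with the new
    one. *)
Lemma stair_P k S p : stair k S -> exists2 S', stair k S' & weq n (rcons S (P k p)) S'.
Proof.
case=> {k S} [k a e|k a t b S ht sS].
  by exists [:: P k (p + a)]; [apply: stair_last | rewrite /= weq_PP].
exists (P k a :: S ++ [:: B k t; P k (p + b)]); first exact: stair_step.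
by rewrite -cats1 /= -catA /= weq_PP.
Qed.

Ltac wcomm g h := rewrite (@weq_comm g h); last by rewrite /disj /gwidth /=; lia.

(* Pulling the staircase below mode [k + 1] out of the way leaves exactly the
   left-hand side of (F) or (G); the right-hand side is again a staircase,
   followed on its right by gates acting below mode [k]. *)
Lemma stair_B k S (t a b th : R) : 0 <= t < pi -> stair k.+1 S ->
  exists S' w, [/\ stair k S', supp k.+1 w &
    weq n (B k th :: P k a :: S ++ [:: B k t; P k b]) (S' ++ w)].
Proof.
move=> ht sS; move: (stair_lt sS); move e: k.+1 sS => k' sS.
case: sS e => {k' S} [k' a' en|k' a' t' b' S2 ht' sS2] ek lt; subst k'.
  (* The middle angle is [a - a'] because the phase [a'] on both modes is first taken out to the
     left by (E). *)
  have [b1 [b2 [b3 [b4 HF]]]] := F_exists t (a - a') th.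
  exists (P k (b3 + a') :: [:: P k.+1 (b4 + a')] ++ [:: B k b2; P k (b + b1)]), [::].
  split=> //.
    apply: stair_step; last exact: stair_last.
    by case: HF => _ [[_ ]].
  rewrite cats0 /= weq_E_left (weq_F _ _ HF); last by lia.
  wcomm (P k.+1 a') (P k b3).
  by rewrite !weq_PP.
have lt2 := stair_lt sS2.
(* Taking [a'] out to the left leaves [a - a'] on mode [k]; pushing [b'] to the right through
   [B k t] adds [- b']. *)
have [d1 [d2 [d3 [d4 [d5 [d6 [d7 [d8 [d9 HG]]]]]]]]] := G_exists t (- b' + (a - a')) t' th.
(* The phase [d9] lands on mode [k.+2], just right of [S2], and is absorbed there. *)
have [S' sS' eS'] := stair_P d9 sS2.
exists (P k (d7 + a') :: (P k.+1 (d8 + a') :: S' ++ [:: B k.+1 d6; P k.+1 d5]) ++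
   [:: B k d4; P k (b + (b' + d2))]), [:: B k.+1 d3; P k.+1 d1; P k.+1 b'].
have in0pi d : d \in [:: d1; d2; d3; d4; d5; d6] -> 0 <= d < pi.
  by case: HG => _ [H _]; apply: H.
split.
- apply: stair_step; first by apply: in0pi; rewrite !inE eqxx !orbT.
  by apply: stair_step => //; apply: in0pi; rewrite !inE eqxx !orbT.
- by rewrite /supp /= !leqnn.
have D2 := stair_supp sS2.
have D' := stair_supp sS'.
rewrite /= -!catA /= weq_E_left (weq_E_right k t b').
wcomm (B k.+1 t') (P k (- b')).
rewrite (@weq_move (P k _) S2); last by apply: supp_disj D2 _; rewrite /gwidth /=; lia.
rewrite weq_PP.
rewrite (@weq_move (B k _) S2); last by apply: supp_disj D2 _; rewrite /gwidth /=; lia.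
wcomm (P k (- b' + (a - a'))) (B k.+1 t').
rewrite (weq_G _ _ HG); last by lia.
rewrite -cat_rcons eS'.
rewrite -(@weq_move (P k.+1 _) S'); last by apply: supp_disj D' _; rewrite /gwidth /=; lia.
rewrite -(@weq_move (P k _) S'); last by apply: supp_disj D' _; rewrite /gwidth /=; lia.
wcomm (P k.+1 d8) (P k d7).
wcomm (P k.+1 a') (P k d7).
rewrite !weq_PP.
wcomm (P k.+1 d1) (P k b').
wcomm (P k.+1 b') (P k b).
wcomm (P k.+1 d1) (P k b).
rewrite !weq_PP.
by wcomm (B k.+1 d3) (P k (b + (b' + d2))).
Qed.

(** A phase on mode [k] merges with the leading phase, and a beam splitter at [k] is handled by
    [stair_B]. A lower gate commutes with the leading phase and enters the inner staircase. *)
Lemma stair_gate k S g : stair k S -> (k <= gpos g)%N ->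
  exists S' w, [/\ stair k S', supp k.+1 w & weq n (g :: S) (S' ++ w)].
Proof.
move=> sS; elim: sS g => {k S} [k a e|k a t b S ht sS IH] g.
  case: g => [i x|i x] /= le; last first.
    by exists [:: P k a], [::]; split=> //;
      [apply: stair_last | apply: weq_out; rewrite /gwidth /=; lia].
  case: (ltngtP k i) le => // [lt _|<- _].
    by exists [:: P k a], [::]; split=> //;
      [apply: stair_last | apply: weq_out; rewrite /gwidth /=; lia].
  by exists [:: P k (a + x)], [::]; split=> //; [apply: stair_last | rewrite weq_PP].
rewrite leq_eqVlt => /orP[/eqP e|lt].
  case: g e => i x /= <-; last exact: stair_B.
  exists (P k (a + x) :: S ++ [:: B k t; P k b]), [::].
  by split=> //; [apply: stair_step | rewrite weq_PP cats0].
have [S' [h [sS' hh eS]]] := IH g lt.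
exists (P k a :: S' ++ [:: B k t; P k b]), h; split; first exact: stair_step.
  exact: supp_le hh.
rewrite weq_comm; last by rewrite /disj /gwidth /= addn1 lt orbT.
rewrite -cat_cons eS /= -!catA /=.
(* The gates left over by the inner staircase start at [k.+2], hence commute with [B k t] and
   [P k b]. *)
have := @weq_swap h [:: B k t; P k b] [::]; rewrite /= !cats0 => -> //.
by apply: sub_all hh => x hx; rewrite /disj /gwidth /=; lia.
Qed.

Lemma supp_stair k w : (k < n)%N -> supp k w ->
  exists S w', [/\ stair k S, supp k.+1 w' & weq n w (S ++ w')].
Proof.
move=> lt; elim: w => [_|g w IH /= /andP[hg /IH[S [w1 [sS h1 e1]]]]].
  by have [S sS eS] := stair_triv lt; exists S, [::]; split; rewrite ?cats0 ?eS.
have [S' [w2 [sS' h2 e2]]] := stair_gate sS hg.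
exists S', (w2 ++ w1); split=> //; first by rewrite /supp all_cat; apply/andP.
by rewrite e1 -cat_cons e2 catA.
Qed.

End Rules.

(** * Completeness *)

Section Phase.
Variable R : realType.
Implicit Types x y : R.

Lemma expiD x y : expi (x + y) = expi x * expi y.
Proof. by rewrite /expi cosD sinD; simpc; congr (_ +i* _); ring. Qed.

Lemma expi0 : expi (0 : R) = 1.
Proof. by rewrite /expi cos0 sin0. Qed.

Lemma cos_eq1 y : 0 <= y < 2 * pi -> cos y = 1 -> y = 0.
Proof.
move=> /andP[y0 y2] c1; have p0 := pi_gt0 R.
case: (leP y pi) => yp.
  by apply: cos_inj; rewrite ?in_itv /= ?y0 ?yp ?lexx ?pi_ge0 ?cos0.
have : 2 * pi - y = 0; last by lra.
apply: cos_inj; rewrite ?in_itv /=; [lra|by rewrite lexx pi_ge0|].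
by rewrite cos0 -[RHS]c1 mulr_natl addrC cosD2pi cosN.
Qed.

End Phase.

Section Completeness.
Variables (R : realType) (n : nat).
Implicit Types (i j k : nat) (w : seq (gate R)) (g : gate R).

(** * Phases modulo [2 * pi] and inverse words *)

Lemma weq_P2pi i w (m : int) : weq n (P i (2 * pi *~ m) :: w) w.
Proof.
have pos (q : nat) (v : seq (gate R)) : weq n (P i (2 * pi *+ q) :: v) v.
  elim: q v => [|q IH] v; first by rewrite mulr0n weq_P0.
  rewrite mulrS -weq_PP IH.
  case: (leqP (i + 1) n) => h; last exact: weq_out.
  exact: (weq_tw (i := i) (ax_A2pi R)).
case: m => q; first exact: pos.
by rewrite -{1}(pos q.+1 w) weq_PP NegzE mulrNz subrr weq_P0.
Qed.

(** The remainder [y] of [x] modulo [2 * pi] lies in [[0, 2 * pi)] and has cosine 1, so [x] is an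
    integer multiple of [2 * pi]. *)
Lemma weq_P_expi1 i x w : expi x = 1 -> weq n (P i x :: w) w.
Proof.
move=> e1; have p0 : 0 < 2 * pi :> R by rewrite mulr_gt0 ?pi_gt0.
pose m := Num.floor (x / (2 * pi)); pose y := x - 2 * pi *~ m.
have ey : expi (2 * pi *~ m) = 1 :> R[i].
  have pos (q : nat) : expi (2 * pi *+ q) = 1 :> R[i].
    elim: q => [|q IH]; rewrite ?mulr0n ?expi0 // mulrS expiD IH mulr1.
    by rewrite /expi mulr_natl cos2pi sin2pi.
  case: (m) => q; first exact: pos.
  by rewrite NegzE mulrNz -[LHS]mulr1 -(pos q.+1) -expiD addNr expi0.
have : y = 0.
  apply: cos_eq1.
    rewrite /y -mulrzl; apply/andP; split.
      by rewrite subr_ge0 -ler_pdivlMr // Num.Theory.ge_floor.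
    by rewrite ltrBlDr -[X in X + _]mul1r -mulrDl -ltr_pdivrMr // addrC
      -[1]/(1%:~R) -intrD floorD1_gt.
  have : expi y = 1 by rewrite -[LHS]mulr1 -[X in _ * X]ey -expiD /y subrK.
  by case.
by move/eqP; rewrite subr_eq0 => /eqP->; rewrite weq_P2pi.
Qed.

(** Beam splitters have no additivity axiom; this instance of (F) makes [bs (- t)] an inverse of
    [bs t]. *)
Lemma F_angles_inv (t : R) : F_angles t 0 (- t) 0 0 0 0.
Proof.
have h1 := in0pi0 R; have h2 := in0pi_in02pi h1.
split; first by do !split.
split; first by split.
split=> [_|]; first by [].
apply/semn_actP; [by split|by split|]; apply/funext => v; apply/funext => j.
have imN : (0 +i* (- sin t)) = - (0 +i* sin t) :> R[i] by simpc.
have cs := cosC2 t.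
case: j => [|[|j]] //=; rewrite ?expi0 ?cosN ?sinN ?cos0 ?sin0 ?imN
  ?mul1r ?mul0r ?addr0 ?add0r.
- move: (cos t)%:C (0 +i* sin t) cs => c s cs; rewrite -[RHS]mul1r -cs; ring.
- move: (cos t)%:C (0 +i* sin t) cs => c s cs.
  rewrite -[RHS]mul1r -cs -[v (1 + _)%N]/(v 1%N); ring.
Qed.

Definition ginv g := match g with P i x => P i (- x) | B i t => B i (- t) end.
Definition winv w := rev (map ginv w).

Lemma ginvK : involutive ginv.
Proof. by case=> i x /=; rewrite opprK. Qed.

Lemma winvK : involutive winv.
Proof. by move=> w; rewrite /winv map_rev revK mapK //; apply: ginvK. Qed.

Lemma weq_ginv g w : weq n [:: ginv g, g & w] w.
Proof.
case: g => i x /=; first by rewrite weq_PP subrr weq_P0.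
case: (leqP (i + 2) n) => h; last by rewrite !weq_out.
(* A zero phase is inserted between the beam splitters to match the left-hand side of (F). *)
rewrite -(@weq_P0 _ _ i (B i x :: w)) (weq_F _ h (F_angles_inv x)).
by rewrite !weq_P0 weq_B0.
Qed.

Lemma weq_winvr w v : weq n (w ++ winv w ++ v) v.
Proof.
elim: w v => //= g w IH v.
rewrite /winv /= rev_cons cat_rcons IH.
by rewrite -{1}(ginvK g) weq_ginv.
Qed.

Lemma weq_winvl w v : weq n (winv w ++ w ++ v) v.
Proof. by rewrite -{2}(winvK w) weq_winvr. Qed.

(** * Action of words on basis vectors and triviality of words acting as the identity *)

Lemma act_place (c : circ R) i k v j : wf c ->
  act (place i c k) v j =
  if (j < i)%N then v j else act c (fun m => v (i + m)%N) (j - i)%N.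
Proof.
move=> w; rewrite /place /= arity_idk !act_idk; case: ltnP => // h.
case: ltnP => // h'; rewrite act_out //; congr v; lia.
Qed.

Lemma act_placeg_lt g v j : (j < gpos g)%N -> act (placeg n g) v j = v j.
Proof.
rewrite /placeg => h; case: ifP => _; last by rewrite act_idk.
by rewrite act_place ?h //; case: g {h}.
Qed.

Lemma act_placeg_zero g v : (forall j, (gpos g <= j)%N -> v j = 0) ->
  act (placeg n g) v = v.
Proof.
move=> v0; apply/funext => j; rewrite /placeg; case: ifP => _; last by rewrite act_idk.
rewrite act_place; last by case: g {v0}.
case: ltnP => // h; rewrite [RHS](v0 _ h).
have z m : v (gpos g + m)%N = 0 by apply: v0; lia.
case: g v0 z h => i x /= v0 z h; first by case: (j - i)%N => [|m]; rewrite z ?mulr0.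
by case: (j - i)%N => [|[|m]]; rewrite !z ?mulr0 ?addr0.
Qed.

Lemma act_supp_lt k w v j : supp k w -> (j < k)%N -> act (cw n w) v j = v j.
Proof.
move=> + lt; elim: w => [_|g w IH /= /andP[h /IH e]] /=; first by rewrite act_idk.
by rewrite act_placeg_lt // (leq_trans lt).
Qed.

Lemma act_supp_zero k w v : supp k w -> (forall j, (k <= j)%N -> v j = 0) ->
  act (cw n w) v = v.
Proof.
move=> + v0; elim: w => [_|g w IH /= /andP[h /IH e]] /=; first by rewrite act_idk.
by rewrite e act_placeg_zero // => j hj; apply: v0; apply: leq_trans hj.
Qed.

Lemma weq_act w w' : weq n w w' -> act (cw n w) = act (cw n w').
Proof. by move/lopp_act; apply; case: (cw_nmode n w). Qed.

Lemma act_cat w w' v : act (cw n (w ++ w')) v = act (cw n w) (act (cw n w') v).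
Proof. by rewrite (lopp_act (cw_cat n w w')) //; case: (cw_nmode n (w ++ w')). Qed.

Lemma act_P i (x : R) v : (i < n)%N -> act (placeg n (P i x)) v i = expi x * v i.
Proof.
move=> h; rewrite /placeg /= addn1 h act_place // ltnn subnn /= addn0 //.
Qed.

Lemma act_B i (t : R) v : (i.+1 < n)%N ->
  act (placeg n (B i t)) v i = (cos t)%:C * v i + (0 +i* sin t) * v i.+1.
Proof.
by move=> h; rewrite /placeg /= addn2 h act_place // ltnn subnn /= addn0 addn1.
Qed.

Lemma supp_out w : supp n w -> weq n w [::].
Proof.
elim: w => //= g w IH /andP[h /IH e]; rewrite weq_out ?e //.
by case: g h => i x; rewrite /gwidth /=; lia.
Qed.

(** Taking moduli, [cos t] has absolute value 1, whereas [sin t] is positive for [t] strictly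
    between 0 and [pi]. *)
Lemma expi_cos_eq1 (x t : R) : 0 <= t < pi -> (cos t)%:C * expi x = 1 -> t = 0.
Proof.
move=> /andP[t0 tp] e; case: (eqVneq t 0) => // tn0.
have st : 0 < sin t by apply: sin_gt0_pi; rewrite lt_def tn0 t0 tp.
have [e1 e2] : cos t * cos x = 1 /\ cos t * sin x = 0.
  by move: e; rewrite /expi; simpc; case.
have := cos2Dsin2 t; have := cos2Dsin2 x; nra.
Qed.

(** Induction on the number of modes from [k] on. Only the [k]-th coordinate of the image of the
    [k]-th basis vector is inspected: for a staircase with a beam splitter it equals [cos t] times
    [expi (a + b)]. *)
Lemma weq_nil k w : supp k w -> act (cw n w) = id -> weq n w [::].
Proof.
have [m] := ubnP (n - k); elim: m k w => // m IH k w lem sw aw.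
case: (leqP n k) => [le|lt]; first exact/supp_out/(supp_le le).
have [S [w' [sS sw' e]]] := supp_stair lt sw.
have aw2 : act (cw n (S ++ w')) = id by rewrite -(weq_act e).
have step w2 : weq n w w2 -> supp k.+1 w2 -> weq n w [::].
  move=> e2 s2; rewrite e2; apply: IH s2 _; first by lia.
  by rewrite -(weq_act e2).
pose v j : R[i] := (j == k)%:R.
have vw : act (cw n w') v = v.
  by apply: act_supp_zero sw' _ => j; rewrite /v; case: ltngtP.
have vk : act (cw n S) v k = 1.
  by have := congr1 (fun f => f v k) aw2; rewrite act_cat vw /v eqxx.
have : (k.+1 = n /\ exists a, S = [:: P k a]) \/
    exists a t b S1, [/\ 0 <= t < pi, stair n k.+1 S1 &
      S = P k a :: S1 ++ [:: B k t; P k b]].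
  case: sS => {k S lem sw lt sw' e aw2 step v vw vk} [k a ek|k a t b S1 ht sS1].
    by left; split=> //; exists a.
  by right; exists a, t, b, S1.
case=> [[ek [a eS]]|[a [t [b [S1 [ht sS1 eS]]]]]]; subst S.
  move: vk; rewrite /= act_idk act_P // /v eqxx mulr1 => ea.
  by apply: step sw'; rewrite e /= weq_P_expi1.
have sup := stair_supp sS1; have lt2 := stair_lt sS1.
(* The inner staircase [S1] lives on modes above [k] in number, so it leaves coordinate [k]
   unchanged. *)
move: vk; rewrite /= act_P // act_cat (act_supp_lt _ sup) //= act_B //.
rewrite act_idk act_P //.
have -> : act (placeg n (P k b)) v k.+1 = 0.
  rewrite /placeg /= addn1 lt act_place // ifF; last by lia.
  by rewrite subSn // subnn /= /v addn1 gtn_eqF.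
rewrite mulr0 addr0 /v eqxx mulr1 mulrCA -expiD => ec.
have t0 := expi_cos_eq1 ht ec; subst t; move: ec; rewrite cos0 mul1r => eab.
apply: (step (S1 ++ w')); last by rewrite /supp all_cat; apply/andP.
(* With its beam splitter gone, [P k b] slides left past [S1] and cancels against [P k a]. *)
rewrite e /= -catA /= weq_B0 -weq_move.
  by rewrite weq_PP weq_P_expi1 // addrC.
by apply: sub_all sup => g hg; rewrite /disj /gwidth /=; lia.
Qed.

End Completeness.

Theorem mainTheorem1 (R : realType) (n : nat) (c1 c2 : circ R) :
  nmode n c1 -> nmode n c2 ->
  (lopp c1 c2 <-> semn n c1 = semn n c2).
Proof.
move=> h1 h2; rewrite semn_actP //; split=> [l|e].
  by apply: lopp_act l _; case: h1.
case: h1 h2 => w1 a1 [w2 a2].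
have := lopp_tw w1; have := lopp_tw w2; rewrite a1 a2.
move: (tw 0 c1) (tw 0 c2) => v1 v2 l2 l1.
have e' : act (cw n v1) = act (cw n v2) by rewrite -(lopp_act l1) // -(lopp_act l2).
apply: lopp_trans l1 (lopp_trans _ (lopp_sym l2)); rewrite -/(weq n v1 v2).
(* This suffices, since [v1] is equivalent to [v2 ++ winv v2 ++ v1]. *)
have : weq n (winv v2 ++ v1) [::].
  apply: (@weq_nil _ _ 0) => //; first by elim: (winv v2 ++ v1).
  apply/funext => v; rewrite act_cat e' -act_cat.
  by have := weq_act (@weq_winvl _ n v2 [::]); rewrite cats0 => ->; rewrite /= act_idk.
by move=> e0; rewrite -{1}(@weq_winvr _ n v2 v1) e0 cats0.
Qed.
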